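(* Let $R$ be a ring. The following are equivalent: (1) $R$ is a regular 2-$\Delta U$ ring. (2) $R$ is a strongly regular 2-$\Delta U$ ring. (3) $R$ is a unit-regular 2-$\Delta U$ ring. (4) $x^3=x$ for every $x\in R$.
   Context: Rings are associative with identity, not necessarily commutative. $U(R)$ is the group of units of $R$. $\Delta(R)=\{r\in R : r+U(R)\subseteq U(R)\}$. A ring $R$ is called 2-$\Delta U$ if $u^2\in 1+\Delta(R)$ for every $u\in U(R)$. $R$ is regular (resp. unit-regular) if for every $a\in R$ there is $x\in R$ (resp. $x\in U(R)$) with $axa=a$; $R$ is strongly regular if $a\in a^2R$ for every $a\in R$. *)

(* Defs.v *)
From mathcomp Require Import all_boot all_algebra.

Set Implicit Arguments.
Unset Strict Implicit.
Unset Printing Implicit Defensive.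

Import GRing.Theory.
Local Open Scope ring_scope.

(* [pzRingType]: associative unital rings, possibly noncommutative and possibly
   zero.  [GRing.unit] is only available on a [unitRingType] (nonzero rings with
   a decidable set of units), hence the propositional notion of unit below. *)
Definition is_unit (R : pzRingType) (u : R) : Prop :=
  exists v : R, u * v = 1 /\ v * u = 1.

Definition Delta (R : pzRingType) (r : R) : Prop :=
  forall u : R, is_unit u -> is_unit (r + u).

Definition two_DeltaU (R : pzRingType) : Prop :=
  forall u : R, is_unit u -> exists d : R, Delta d /\ u ^+ 2 = 1 + d.

Definition regular_ring (R : pzRingType) : Prop :=
  forall a : R, exists x : R, a * x * a = a.

Definition unit_regular_ring (R : pzRingType) : Prop :=
  forall a : R, exists x : R, is_unit x /\ a * x * a = a.

Definition strongly_regular_ring (R : pzRingType) : Prop :=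
  forall a : R, exists x : R, a = a ^+ 2 * x.

(* Main.v *)
Require Import Defs.
From mathcomp Require Import all_boot all_algebra.

Set Implicit Arguments.
Unset Strict Implicit.
Unset Printing Implicit Defensive.

Import GRing.Theory.
Local Open Scope ring_scope.

(** A nonzero square-zero element of a regular ring yields 2 x 2 matrix units
    in a corner eRe.  The matrix [[0, 1], [1, 1]], extended by 1 - e, is a unit
    u with u^2 - 1 = u - (1 - e); if this were in Delta(R), then subtracting u
    would make 1 - e a unit, so e = 0.  Hence a regular 2-Delta-U ring is
    reduced, its idempotents are central, and every a has a commuting inner
    inverse y.  With e = ay, the elements a + (1 - e) and y + (1 - e) are
    mutually inverse units; this forces Delta(R) = 0, so
    (a + (1 - e))^2 = 1, that is a^2 = e and a^3 = a. *)

Definition reduced_ring (R : pzRingType) : Prop :=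
  forall a : R, a * a = 0 -> a = 0.

Section Units.

Variable R : pzRingType.
Implicit Types a b e r u v x y : R.

Lemma is_unitN u : is_unit u -> is_unit (- u).
Proof. by case=> v [uv vu]; exists (- v); rewrite !mulrNN. Qed.

Lemma is_unitM u v : is_unit u -> is_unit v -> is_unit (u * v).
Proof.
case=> u' [uu' u'u] [v' [vv' v'v]]; exists (v' * u').
by rewrite mulrA -(mulrA u) vv' mulr1 uu' mulrA -(mulrA v') u'u mulr1 v'v.
Qed.

(** Factor [u * r + v] as [u * (r + u' * v)], where [u'] is the inverse of [u]. *)
Lemma Delta_unitM u r : is_unit u -> Delta r -> Delta (u * r).
Proof.
move=> unit_u Dr v unit_v; have [u' [uu' u'u]] := unit_u.
have unit_u' : is_unit u' by exists u.
rewrite -[v]mul1r -uu' -mulrA -mulrDr.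
exact/is_unitM/Dr/is_unitM.
Qed.

Lemma idem_compl_unit_eq0 e : e * e = e -> is_unit (1 - e) -> e = 0.
Proof.
by move=> ee [v [ev _]]; rewrite -[e]mulr1 -ev mulrA mulrBr mulr1 ee subrr mul0r.
Qed.

Lemma Delta_idem_eq0 e : e * e = e -> Delta e -> e = 0.
Proof.
move=> ee De; apply: idem_compl_unit_eq0 => //.
rewrite -opprB; apply/is_unitN/De; apply/is_unitN.
by exists 1; rewrite !mulr1.
Qed.

(** Both off-diagonal Peirce components [e * x * (1 - e)] and [(1 - e) * x * e] square to zero,
    hence vanish. *)
Lemma reduced_idem_central e x : reduced_ring R -> e * e = e -> e * x = x * e.
Proof.
move=> redR ee.
have eC : e * (1 - e) = 0 by rewrite mulrBr mulr1 ee subrr.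
have Ce : (1 - e) * e = 0 by rewrite mulrBl mul1r ee subrr.
have /redR : (e * x * (1 - e)) * (e * x * (1 - e)) = 0.
  by rewrite -!mulrA (mulrA (1 - e)) Ce mul0r !mulr0.
have /redR : ((1 - e) * x * e) * ((1 - e) * x * e) = 0.
  by rewrite -!mulrA (mulrA e) eC mul0r !mulr0.
rewrite mulrBl mul1r mulrBl mulrBr mulr1.
by move=> /subr0_eq -> /subr0_eq.
Qed.

(** Inverses in the corner eRe extend to R by the identity of the complementary corner, since mixed
    products vanish. *)
Lemma corner_unit e w v :
    [/\ e * w = w, w * e = w, e * v = v & v * e = v] ->
    w * v = e -> v * w = e ->
  is_unit (w + (1 - e)).
Proof.
move=> [ew we ev ve] wv vw; exists (v + (1 - e)).
have ee : e * e = e by rewrite -{1}wv -mulrA ve.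
have CM x : e * x = x -> (1 - e) * x = 0.
  by rewrite mulrBl mul1r => ->; rewrite subrr.
have MC x : x * e = x -> x * (1 - e) = 0.
  by rewrite mulrBr mulr1 => ->; rewrite subrr.
have CC : (1 - e) * (1 - e) = 1 - e by rewrite mulrBr mulr1 (CM e ee) subr0.
by split; rewrite mulrDl 2![_ * (_ + (1 - e))]mulrDr ?wv ?vw CC MC // CM //
  addr0 add0r addrC subrK.
Qed.

Lemma square_zero_matrix_units a :
    regular_ring R -> a * a = 0 ->
  exists b, [/\ b * b = 0, a * b * a = a & b * a * b = b].
Proof.
move=> regR aa; have [x axa] := regR a.
have [f fE] : exists f, f = a * x by exists (a * x).
have fa : f * a = a by rewrite fE.
have ff : f * f = f by rewrite {2}fE mulrA fa -fE.
have af : a * f = 0 by rewrite fE mulrA aa mul0r.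
have fC : f * (1 - f) = 0 by rewrite mulrBr mulr1 ff subrr.
have aC : a * (1 - f) = a by rewrite mulrBr mulr1 af subr0.
have ab : a * ((1 - f) * x * f) = f by rewrite !mulrA aC -fE ff.
(* The inner inverse [x] is cut down on both sides: the factor [1 - f] makes the square vanish and,
   as [a * (1 - f) = a], leaves the product with [a] equal to [f]. *)
exists ((1 - f) * x * f); split.
- by rewrite -!mulrA (mulrA f) fC mul0r !mulr0.
- by rewrite ab.
- by rewrite -(mulrA _ a) ab -(mulrA _ f f) ff.
Qed.

Lemma regular_two_DeltaU_reduced :
  regular_ring R -> two_DeltaU R -> reduced_ring R.
Proof.
move=> regR DU a aa.
have [b [bb aba bab]] := square_zero_matrix_units regR aa.
(* With [a] and [b] as off-diagonal matrix units, [a * b] and [b * a] are the diagonal ones, so [e]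
   is the identity of the corner. *)
pose e := a * b + b * a.
have ea : e * a = a by rewrite mulrDl aba -mulrA aa mulr0 addr0.
have ae : a * e = a by rewrite mulrDr !mulrA aa mul0r add0r aba.
have eb : e * b = b by rewrite mulrDl bab -mulrA bb mulr0 add0r.
have be : b * e = b by rewrite mulrDr !mulrA bab bb mul0r addr0.
have ee : e * e = e by rewrite {2}/e mulrDr !mulrA ea eb.
(* the matrix [[0, 1], [1, 1]], with inverse w - e in the corner e R e *)
pose w := a + b + b * a.
have ew : e * w = w by rewrite !mulrDr mulrA ea eb.
have we : w * e = w by rewrite !mulrDl -mulrA ae be.
have ww : w * w = w + e.
  rewrite /w !mulrDl !mulrDr !mulrA aa bb aba bab.
  rewrite -(mulrA b a a) aa mulr0 !mul0r !addr0 !add0r.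
  by rewrite [RHS]addrC -!addrA [in RHS](addrCA _ a).
have unit_u : is_unit (w + (1 - e)).
  apply: (@corner_unit _ _ (w - e)).
  - by split=> //; rewrite ?mulrBr ?mulrBl ?ew ?we ee.
  - by rewrite mulrBr ww we addrC addKr.
  - by rewrite mulrBl ww ew addrC addKr.
have uu : (w + (1 - e)) ^+ 2 = 1 + w.
  have wC : w * (1 - e) = 0 by rewrite mulrBr mulr1 we subrr.
  have Cw : (1 - e) * w = 0 by rewrite mulrBl mul1r ew subrr.
  have CC : (1 - e) * (1 - e) = 1 - e.
    by rewrite mulrBr mulr1 mulrBl mul1r ee subrr subr0.
  rewrite expr2 mulrDl 2![_ * (w + (1 - e))]mulrDr wC Cw CC ww addr0 add0r.
  by rewrite addrACA addrA -addrA addrN addr0 addrC.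
have [d [Dd]] := DU _ unit_u; rewrite uu => /addrI wd.
(* Here [w] equals [d], which lies in Delta(R), and it is added to the unit [- (w + (1 - e))]. *)
have /is_unitN : is_unit (w - (w + (1 - e))).
  by rewrite {1}wd; apply/Dd/is_unitN.
rewrite opprB addrC addKr => /(idem_compl_unit_eq0 ee) e0.
by rewrite -ea e0 mul0r.
Qed.

Lemma group_inverse a :
    regular_ring R -> reduced_ring R ->
  exists y, [/\ a * y = y * a, a * y * a = a & y * a * y = y].
Proof.
move=> regR redR; have [x axa] := regR a.
have cen e z := @reduced_idem_central e z redR.
have eI : (a * x) * (a * x) = a * x by rewrite mulrA axa.
have fI : (x * a) * (x * a) = x * a.
  by rewrite mulrA -(mulrA x a x) -(mulrA x) axa.
(* By centrality each of the two idempotents absorbs the other: both equal their product. *)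
have ef : a * x = x * a.
  have fe : x * a * (a * x) = a * x.
    rewrite -[RHS]eI -[RHS]mulrA (mulrA x a x) [RHS]mulrA.
    by rewrite -(cen _ a fI) mulrA.
  rewrite -fe -(cen _ _ eI) -[RHS]fI -[RHS]mulrA (mulrA a x a).
  by rewrite [RHS]mulrA -(cen _ x eI) mulrA.
exists (x * a * x); split.
- by rewrite !mulrA axa ef -(mulrA (x * a)) fI.
- by rewrite !mulrA axa.
- by rewrite !mulrA -(mulrA (x * a) x a) fI -(mulrA (x * a) x a) fI.
Qed.

Lemma strongly_regular_reduced : strongly_regular_ring R -> reduced_ring R.
Proof.
by move=> sreg a aa; have [x ->] := sreg a; rewrite expr2 aa mul0r.
Qed.

Lemma strongly_regular_regular : strongly_regular_ring R -> regular_ring R.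
Proof.
move=> sreg a; have [x aE] := sreg a; exists x.
have aax z : a * (a * (x * z)) = a * z by rewrite !mulrA -expr2 -aE.
(* The defect [a - a * x * a] squares to zero, because [a * a * x = a]. *)
apply/esym/subr0_eq/(strongly_regular_reduced sreg).
by rewrite mulrBl !mulrBr -!mulrA !aax !subrr.
Qed.

Lemma regular_reduced_strongly_regular :
  regular_ring R -> reduced_ring R -> strongly_regular_ring R.
Proof.
move=> regR redR a; have [y [ay aya _]] := group_inverse a regR redR.
by exists y; rewrite expr2 -mulrA ay mulrA aya.
Qed.

Lemma group_inverse_units a y :
    a * y = y * a -> a * y * a = a -> y * a * y = y ->
  is_unit (a + (1 - a * y)) /\ is_unit (y + (1 - a * y)).
Proof.
move=> ay aya yay.
have ya_y : a * y * y = y by rewrite ay.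
have a_ay : a * (a * y) = a by rewrite ay mulrA.
have y_ay : y * (a * y) = y by rewrite mulrA.
by split; [apply: (@corner_unit _ _ y) | apply: (@corner_unit _ _ a)].
Qed.

Lemma regular_reduced_unit_regular :
  regular_ring R -> reduced_ring R -> unit_regular_ring R.
Proof.
move=> regR redR a; have [y [ay aya yay]] := group_inverse a regR redR.
exists (y + (1 - a * y)); split; first by case: (group_inverse_units ay aya yay).
by rewrite mulrDr mulrDl aya mulrBr mulr1 ay mulrA aya subrr mul0r addr0.
Qed.

Lemma regular_reduced_Delta_eq0 r :
  regular_ring R -> reduced_ring R -> Delta r -> r = 0.
Proof.
move=> regR redR Dr; have [y [ry ryr yry]] := group_inverse r regR redR.
have [_ unit_y] := group_inverse_units ry ryr yry.
have e0 : r * y = 0.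
  apply: Delta_idem_eq0; first by rewrite mulrA ryr.
  (* A unit multiple of [r] is idempotent, and Delta(R) contains no nonzero idempotent. *)
  have -> : r * y = (y + (1 - r * y)) * r.
    by rewrite mulrDl mulrBl mul1r ryr subrr addr0.
  exact: Delta_unitM.
by rewrite -ryr e0 mul0r.
Qed.

Lemma regular_two_DeltaU_cube :
  regular_ring R -> two_DeltaU R -> forall x, x ^+ 3 = x.
Proof.
move=> regR DU a; have redR := regular_two_DeltaU_reduced regR DU.
have [y [ay aya yay]] := group_inverse a regR redR.
have [unit_u _] := group_inverse_units ay aya yay.
have [d [/(regular_reduced_Delta_eq0 regR redR) -> uu]] := DU _ unit_u.
(* Left multiplication by the unit u agrees with that by [a] on aR, so a^3 = u^2 a. *)
have ua : (a + (1 - a * y)) * a = a * a.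
  by rewrite mulrDl mulrBl mul1r aya subrr addr0.
by rewrite exprSr expr2 -ua -mulrA -ua mulrA -expr2 uu addr0 mul1r.
Qed.

Lemma cube_regular_two_DeltaU :
  (forall x : R, x ^+ 3 = x) -> regular_ring R /\ two_DeltaU R.
Proof.
move=> x3; split=> [a | u [v [uv _]]].
  by exists a; rewrite -mulrA -expr2 -exprS.
exists 0; split=> [w | ]; first by rewrite add0r.
(* Cancelling the unit [u] in u^3 = u gives u^2 = 1. *)
by rewrite addr0 -[LHS]mulr1 -uv mulrA -exprSr x3.
Qed.

End Units.

Lemma unit_regular_regular (R : pzRingType) :
  unit_regular_ring R -> regular_ring R.
Proof. by move=> ureg a; have [x [_ axa]] := ureg a; exists x. Qed.

Theorem theorem3p20 (R : pzRingType) :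
  [<-> regular_ring R /\ two_DeltaU R;
       strongly_regular_ring R /\ two_DeltaU R;
       unit_regular_ring R /\ two_DeltaU R;
       forall x : R, x ^+ 3 = x].
Proof.
tfae.
- move=> [regR DU]; split=> //.
  exact/regular_reduced_strongly_regular/regular_two_DeltaU_reduced.
- move=> [sreg DU]; split=> //; apply: regular_reduced_unit_regular.
    exact: strongly_regular_regular.
  exact: strongly_regular_reduced.
- move=> [/unit_regular_regular regR DU].
  exact: regular_two_DeltaU_cube.
- exact: cube_regular_two_DeltaU.
Qed.
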